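(* Let $k\in\mathbb{N}$, $x\in\mathbb{R}$ and $s\in\mathbb{C}$ with $\operatorname{Re}(s)>2$ and $|kx|<1$. Then $$\zeta(s)\,\zeta_2(x:s,k)=\zeta(s-1)\,Li_s(kx),$$ where $\zeta$ is the Riemann zeta function.
   Context: $\phi$ is Euler's totient function. For $k,n\in\mathbb{N}$ and $x\in\mathbb{R}$ define $N_k(x:n)=\frac{1}{n}\sum_{d\mid n}\phi\!\left(\frac{n}{d}\right)k^dx^d$, and $\zeta_2(x:s,k)=\sum_{n=1}^{\infty}\frac{nN_k(x:n)}{n^s}$. The polylogarithm is $Li_s(z)=\sum_{n=1}^{\infty}\frac{z^n}{n^s}$. *)

(* Defs.v *)
From HB Require Import structures.
From mathcomp Require Import all_boot all_order all_algebra.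
From mathcomp Require Import all_classical all_reals all_analysis.
From mathcomp Require Import complex.

Set Implicit Arguments.
Unset Strict Implicit.
Unset Printing Implicit Defensive.

Import Order.TTheory GRing.Theory Num.Theory.
Import numFieldNormedType.Exports.

Local Open Scope classical_set_scope.
Local Open Scope ring_scope.
Local Open Scope complex_scope.

Definition cexp (R : realType) (z : R[i]) : R[i] :=
  (expR (complex.Re z) * cos (complex.Im z)) +i* (expR (complex.Re z) * sin (complex.Im z)).

(* n ^ s = exp (s log n); only meaningful for n > 0. *)
Definition natcpow (R : realType) (n : nat) (s : R[i]) : R[i] :=
  cexp (s * (ln (n%:R : R))%:C).

(* sum_(n >= 1) a n / n ^ s: the index is shifted so that the sum starts
   at n = 1, and the limit is taken in the topology of the modulus on
   R[i]^o. *)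
Definition dirichlet_terms (R : realType) (a : nat -> R[i]) (s : R[i]) :
    nat -> R[i]^o :=
  fun n => a n.+1 / natcpow n.+1 s.

Definition dirichlet_cvg (R : realType) (a : nat -> R[i]) (s : R[i]) : Prop :=
  cvgn (series (dirichlet_terms a s)).

Definition dirichlet_sum (R : realType) (a : nat -> R[i]) (s : R[i]) : R[i] :=
  limn (series (dirichlet_terms a s)).

Definition zeta_coef (R : realType) (n : nat) : R[i] := 1.

(* The Riemann zeta function on its half-plane of convergence 1 < Re s
   (no analytic continuation elsewhere). *)
Definition zeta (R : realType) (s : R[i]) : R[i] :=
  dirichlet_sum (@zeta_coef R) s.

Definition Li_coef (R : realType) (z : R[i]) (n : nat) : R[i] := z ^+ n.

Definition Li (R : realType) (s z : R[i]) : R[i] :=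
  dirichlet_sum (Li_coef z) s.

Definition Nk (R : realType) (k : nat) (x : R) (n : nat) : R :=
  n%:R^-1 *
  \sum_(d <- divisors n) (totient (n %/ d))%:R * k%:R ^+ d * x ^+ d.

Definition zeta2_coef (R : realType) (k : nat) (x : R) (n : nat) : R[i] :=
  (n%:R * Nk k x n)%:C.

Definition zeta2 (R : realType) (x : R) (s : R[i]) (k : nat) : R[i] :=
  dirichlet_sum (zeta2_coef k x) s.

(* Main.v *)
(* zeta2 is the Dirichlet series of phi * (kx)^., so zeta * zeta2 is that of
   (kx)^. * (phi * 1) = (kx)^. * id, whose factors are Li_s(kx) and zeta(s - 1).
   Products of absolutely convergent Dirichlet series are handled with partial
   sums A_N, B_N and C_N = sum over i j <= N: the error |A_N B_N - C_N| is at
   most its analogue for the moduli, and for nonnegative terms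
   A_M B_M <= C_(M^2) <= A_(M^2) B_(M^2) forces C_N to converge to the product
   of the limits. *)
Require Import Defs.
From HB Require Import structures.
From mathcomp Require Import all_boot all_order all_algebra.
From mathcomp Require Import all_classical all_reals all_analysis.
From mathcomp Require Import complex.

Import Order.TTheory GRing.Theory Num.Theory.
Import numFieldNormedType.Exports.
Local Open Scope ring_scope.
Local Open Scope complex_scope.
From mathcomp Require Import cyclic ring lra.
Import ComplexField.Normc.
Local Open Scope classical_set_scope.

(** * Dirichlet convolution as sums over a box of index pairs *)

Lemma divisors_perm n N : (0 < n <= N)%N ->
  perm_eq (divisors n) [seq d <- index_iota 1 N.+1 | (d %| n)%N].
Proof.
case/andP=> n0 nN.
apply: uniq_perm; [exact: divisors_uniq | exact/filter_uniq/iota_uniq |].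
move=> d; rewrite -dvdn_divisors// mem_filter mem_index_iota ltnS.
case: (boolP (d %| n)%N) => //= dn.
by rewrite (dvdn_gt0 n0 dn) (leq_trans (dvdn_leq n0 dn)).
Qed.

Section DirichletConvolution.
Context {A : comNzRingType}.
Implicit Types u v w : nat -> A.

Definition dconv u v (n : nat) : A :=
  \sum_(d <- divisors n) u d * v (n %/ d)%N.

(** Each divisor [i] leaves the single partner [j = n / i]. The bound [N] is free, so convolutions
    at different [n] share one index range and sums can be exchanged. *)
Lemma dconvE N u v n : (0 < n <= N)%N ->
  dconv u v n =
  \sum_(1 <= i < N.+1) \sum_(1 <= j < N.+1 | (i * j == n)%N) u i * v j.
Proof.
move=> /[dup] nN /andP[n0 n_le].
rewrite /dconv (perm_big _ (divisors_perm _ _ nN)) /= big_filter big_mkcond.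
apply: eq_big_nat => i /andP[i0 _]; case: ifPn => [/dvdnP[q nE]|nin].
  rewrite nE mulnK//; have := n0; rewrite nE muln_gt0 => /andP[q0 _].
  under eq_bigl => j do rewrite mulnC eqn_pmul2r//.
  rewrite big_nat1_eq ltnS q0 (leq_trans _ n_le)//= nE; exact: leq_pmulr.
rewrite big1// => j /eqP ij.
by move: nin; rewrite -ij dvdn_mulr.
Qed.

(** A pair with [i * j <= N] is counted once, at [n = i * j]: the partial sum runs over the lattice
    points under a hyperbola. *)
Lemma sum_dconv u v N :
  \sum_(1 <= n < N.+1) dconv u v n =
  \sum_(1 <= i < N.+1) \sum_(1 <= j < N.+1 | (i * j <= N)%N) u i * v j.
Proof.
under eq_big_nat => n nN do rewrite (dconvE N)//.
rewrite exchange_big/=; apply: eq_big_nat => i /andP[i0 _].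
under eq_bigr => n _ do rewrite big_mkcond/=.
rewrite exchange_big/= [RHS]big_mkcond; apply: eq_big_nat => j /andP[j0 _].
rewrite -big_mkcond/=; under eq_bigl => n do rewrite eq_sym.
by rewrite (big_nat1_eq _ (fun=> u i * v j)) ltnS muln_gt0 i0 j0.
Qed.

(** Both sides equal the sum of [u i * v j * w k] over triples with product [n]. *)
Lemma dconvA u v w n : (0 < n)%N ->
  dconv (dconv u v) w n = dconv u (dconv v w) n.
Proof.
move=> n0; rewrite !(dconvE n) ?n0 ?leqnn//.
transitivity (\sum_(1 <= i < n.+1) \sum_(1 <= j < n.+1)
   \sum_(1 <= k < n.+1 | (i * j * k == n)%N) u i * v j * w k).
  under eq_big_nat => m mn.
    under eq_bigr => k _ do rewrite (dconvE n)// mulr_suml.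
    rewrite exchange_big/=.
    under eq_bigr => i _ do under eq_bigr => k _ do rewrite mulr_suml big_mkcond.
    under eq_bigr => i _ do rewrite exchange_big/=.
    over.
  rewrite exchange_big/=; apply: eq_big_nat => i /andP[i0 _].
  rewrite exchange_big/=; apply: eq_big_nat => j /andP[j0 _].
  under eq_bigr => m _ do rewrite big_mkcond/=.
  rewrite exchange_big/= [RHS]big_mkcond; apply: eq_big_nat => k /andP[k0 _].
  under eq_bigr => m _ do rewrite -if_and andbC if_and.
  rewrite -big_mkcond/=; under eq_bigl => m do rewrite eq_sym.
  (* Only [m = i * j] survives, and it lies in the range because [i * j * k = n] with [k > 0]. *)
  rewrite (big_nat1_eq _ (fun m => if (m * k == n)%N then u i * v j * w k else 0)).
  case: eqP => [ijk|_]; last by rewrite if_same.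
  by rewrite muln_gt0 i0 j0 ltnS -ijk leq_pmulr.
apply: eq_big_nat => i /andP[i0 _]; apply/esym.
(* The inner product [m = j * k] keeps its own index, so that it can be moved innermost and then
   eliminated. *)
transitivity (\sum_(1 <= m < n.+1) \sum_(1 <= j < n.+1) \sum_(1 <= k < n.+1)
   if (m == j * k)%N then if (i * m == n)%N then u i * v j * w k else 0 else 0).
  rewrite big_mkcond; apply: eq_big_nat => m mn; case: ifP => _.
    rewrite (dconvE n)// mulr_sumr; apply: eq_bigr => j _.
    rewrite mulr_sumr big_mkcond; apply: eq_bigr => k _.
    by rewrite eq_sym mulrA.
  by rewrite big1// => j _; rewrite big1// => k _; rewrite if_same.
rewrite exchange_big/=; apply: eq_big_nat => j /andP[j0 _].
rewrite exchange_big/= [RHS]big_mkcond; apply: eq_big_nat => k /andP[k0 _].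
rewrite -big_mkcond/= big_nat1_eq ltnS muln_gt0 j0 k0 mulnA/=.
case: eqP => [ijk|_]; last by rewrite if_same.
by rewrite -ijk -mulnA leq_pmull.
Qed.

End DirichletConvolution.

(** * Nonnegative real series: products and the p-series *)

Section PositiveSeries.
Context {R : realType}.
Implicit Types a b : nat -> R.

Lemma psum_nondecreasing a : (forall n, 0 <= a n) ->
  {homo (fun N => \sum_(1 <= n < N.+1) a n) : M N / (M <= N)%N >-> M <= N}.
Proof.
move=> a0 M N MN; rewrite [leRHS](big_cat_nat _ (n := M.+1))//=.
by rewrite lerDl sumr_ge0.
Qed.

Lemma psum_dconv_le a b N : (forall n, 0 <= a n) -> (forall n, 0 <= b n) ->
  \sum_(1 <= n < N.+1) dconv a b n <=
  (\sum_(1 <= n < N.+1) a n) * (\sum_(1 <= n < N.+1) b n).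
Proof.
move=> a0 b0; rewrite sum_dconv mulr_suml ler_sum// => i _.
rewrite mulr_sumr big_mkcond ler_sum// => j _.
by case: ifP => // _; rewrite mulr_ge0.
Qed.

(** The square [i, j <= M] lies under the hyperbola [i * j <= M * M]; the other terms are
    nonnegative. *)
Lemma psum_dconv_ge a b M : (forall n, 0 <= a n) -> (forall n, 0 <= b n) ->
  (\sum_(1 <= n < M.+1) a n) * (\sum_(1 <= n < M.+1) b n) <=
  \sum_(1 <= n < (M * M).+1) dconv a b n.
Proof.
move=> a0 b0; rewrite sum_dconv mulr_suml.
have MM : (M.+1 <= (M * M).+1)%N by rewrite ltnS; case: M => // M; rewrite leq_pmulr.
rewrite [leRHS](big_cat_nat _ (n := M.+1))//= -[leLHS]addr0 lerD//; last first.
  by rewrite sumr_ge0// => i _; rewrite sumr_ge0// => j _; rewrite mulr_ge0.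
rewrite ler_sum_nat// => i /andP[i0 iM].
rewrite mulr_sumr [leRHS](big_cat_nat _ (n := M.+1))//=.
rewrite -[leLHS]addr0 lerD//; last first.
  by rewrite sumr_ge0// => j _; rewrite mulr_ge0.
rewrite [leRHS]big_mkcond ler_sum_nat// => j /andP[j0 jM].
by rewrite leq_mul.
Qed.

Lemma cvg_psum_dconv a b (la lb : R) :
  (forall n, 0 <= a n) -> (forall n, 0 <= b n) ->
  (fun N => \sum_(1 <= n < N.+1) a n) @ \oo --> la ->
  (fun N => \sum_(1 <= n < N.+1) b n) @ \oo --> lb ->
  (fun N => \sum_(1 <= n < N.+1) dconv a b n) @ \oo --> la * lb.
Proof.
move=> a0 b0 cva cvb.
have cvab : (\sum_(1 <= n < N.+1) a n) * (\sum_(1 <= n < N.+1) b n)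
    @[N --> \oo] --> la * lb by exact: cvgM cva cvb.
have c0 n : 0 <= dconv a b n.
  by rewrite /dconv sumr_ge0// => d _; rewrite mulr_ge0.
have Cnd := psum_nondecreasing _ c0.
have P_le N : (\sum_(1 <= n < N.+1) a n) * (\sum_(1 <= n < N.+1) b n) <= la * lb.
  rewrite ler_pM ?sumr_ge0//.
    rewrite -(cvg_lim (@norm_hausdorff _ _) cva).
    by apply: (nondecreasing_cvgn_le (psum_nondecreasing _ a0)); apply: cvgP cva.
  rewrite -(cvg_lim (@norm_hausdorff _ _) cvb).
  by apply: (nondecreasing_cvgn_le (psum_nondecreasing _ b0)); apply: cvgP cvb.
have C_le N := le_trans (psum_dconv_le a b N a0 b0) (P_le N).
have Ccvg : cvgn (fun N => \sum_(1 <= n < N.+1) dconv a b n).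
  by apply: nondecreasing_is_cvgn => //; exists (la * lb) => _ [N _ <-].
suff -> : la * lb = limn (fun N => \sum_(1 <= n < N.+1) dconv a b n) by [].
(* The upper bound is [C_le]. For the lower one, each product of partial sums up to [M] is at most
   the convolution sum up to [M * M], hence at most its limit. *)
apply/eqP; rewrite eq_le; apply/andP; split; last first.
  by apply: limr_le => //; apply: nearW.
rewrite -(cvg_lim (@norm_hausdorff _ _) cvab).
apply: limr_le; first exact: cvgP cvab.
apply: nearW => M /=; apply: le_trans (psum_dconv_ge a b M a0 b0) _.
exact: (nondecreasing_cvgn_le Cnd Ccvg (M * M)%N).
Qed.

Lemma cvg_series_riemannR (p : R) : 1 < p -> cvgn (series (riemannR p)).
Proof.
rewrite -subr_gt0; set q := p - 1 => q0.
have pE : p = q + 1 by rewrite /q subrK.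
have rp0 n : 0 <= riemannR p n by rewrite ltW// riemannR_gt0// pE addr_ge0// ltW.
apply: nondecreasing_is_cvgn; first by apply: nondecreasing_series.
(* Telescoping: [q / (n+1)^(q+1) <= 1/n^q - 1/(n+1)^q]. *)
have step n : riemannR p n.+1 <= q^-1 * (n.+1%:R `^ (- q) - n.+2%:R `^ (- q)).
  rewrite ler_pdivlMl// /riemannR -powRN pE opprD powRD; last first.
    by apply/implyP => _; rewrite pnatr_eq0.
  rewrite powR_inv1// mulrCA lerBrDr.
  rewrite -[X in _ + X]mulr1 -mulrDr.
  have powE m : (m.+1%:R : R) `^ (- q) = expR (- q * ln m.+1%:R).
    by rewrite /powR pnatr_eq0.
  rewrite !powE.
  set l1 := ln n.+1%:R; set l2 := ln n.+2%:R.
  have -> : - q * l1 = - q * l2 + q * (l2 - l1) by ring.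
  rewrite expRD ler_pM2l ?expR_gt0//.
  (* What remains is $1 + q/(n+2) \le e^{q(l_2-l_1)}$. By $1+t \le e^t$ it suffices that $1/(n+2)
     \le l_2-l_1$, which is $\ln(1-1/(n+2)) \le -1/(n+2)$. *)
  apply: le_trans (expR_ge1Dx _); rewrite addrC lerD2l ler_pM2l//.
  rewrite lerBrDr addrC -lerBrDr.
  have -> : l1 = l2 + ln (1 + - n.+2%:R^-1).
    rewrite -lnM ?posrE ?ltr0n//; last by rewrite subr_gt0 invf_lt1 ?ltr1n.
    by rewrite mulrDr mulr1 mulrN divff ?pnatr_eq0// -[n.+2%:R]natr1 addrK.
  rewrite lerD2l le_ln1Dx// ltrN2 invf_lt1 ?ltr1n// ltr1n.
exists (1 + q^-1) => _ [N _ <-].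
(* The telescoped form is what induction can carry. It starts from one term, equal to 1, since
   [step] bounds only the later ones. *)
suff : series (riemannR p) N.+1 <= 1 + q^-1 * (1 - N.+1%:R `^ (- q)).
  move=> SN1; apply: (@le_trans _ _ (series (riemannR p) N.+1)).
    by rewrite seriesSr lerDl.
  apply: le_trans SN1 _.
  rewrite lerD2l ler_piMr ?invr_ge0 ?(ltW q0)// gerBl; exact: powR_ge0.
elim: N => [|N IH].
  by rewrite seriesEnat/= big_nat1 /riemannR powR1 invr1 subrr mulr0 addr0.
rewrite seriesSr; apply: le_trans (lerD IH (step N)) _.
by rewrite -addrA -mulrDr addrA subrK.
Qed.
End PositiveSeries.

(** * Absolutely convergent complex series and their products *)

Section ComplexSeries.
Context {R : realType}.
Implicit Types u v : nat -> R[i].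

(** The norm of [R[i]] takes values in [R[i]]; [normc] is the same modulus in [R], where monotone
    convergence and comparison apply. *)
Lemma norm_normc (z : R[i]) : `|z| = (normc z)%:C.
Proof. by []. Qed.

Lemma normc_ge0 (z : R[i]) : 0 <= normc z.
Proof. by case: z => a b; exact: sqrtr_ge0. Qed.

Lemma normc_ge_abs_Re (z : R[i]) : `|complex.Re z| <= normc z.
Proof. by rewrite -lecR -norm_normc normc_ge_Re. Qed.

Lemma normc_ge_abs_Im (z : R[i]) : `|complex.Im z| <= normc z.
Proof.
case: z => a b; rewrite /= -(sqrtr_sqr b).
by rewrite ler_sqrt ?addr_ge0 ?sqr_ge0// lerDr sqr_ge0.
Qed.

Lemma normc_real (x : R) : normc x%:C = `|x|.
Proof. by rewrite /= expr0n/= addr0 sqrtr_sqr. Qed.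

Lemma normc_sum (I : Type) (r : seq I) (P : pred I) (F : I -> R[i]) :
  normc (\sum_(i <- r | P i) F i) <= \sum_(i <- r | P i) normc (F i).
Proof.
rewrite -lecR -norm_normc (rmorph_sum (real_complex R)); exact: ler_norm_sum.
Qed.

Lemma normc_le_ReIm (z : R[i]) :
  normc z <= `|complex.Re z| + `|complex.Im z|.
Proof.
rewrite {1}(complexE z) (le_trans (le_normcD _ _))// normcM.
by rewrite !normc_real /= expr0n/= add0r expr1n sqrtr1 mul1r.
Qed.

Lemma cvg_normc (u : nat -> R[i]^o) (l : R[i]^o) :
  normc (u n - l) @[n --> \oo] --> (0 : R) -> u @ \oo --> l.
Proof.
move=> /cvgr0Pnorm_le h; apply/cvgrPdist_le => e e0.
(* A positive element of [R[i]] is real, so the tolerance comes from [R]. *)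
have eE : e = (complex.Re e)%:C by rewrite RRe_real// gtr0_real.
move: e0; rewrite eE ltcR => /h; apply: filterS => n.
by rewrite distrC norm_normc lecR ger0_norm ?normc_ge0.
Qed.

Lemma psumE {V : zmodType} (f : nat -> V) :
  series (fun n => f n.+1) = (fun N => \sum_(1 <= n < N.+1) f n).
Proof. by apply/funext => N; rewrite seriesEnat/= big_add1. Qed.

Definition abs_cvg u : Prop :=
  cvgn (fun N => \sum_(1 <= n < N.+1) normc (u n)).

(** Real and imaginary parts are dominated by the modulus, so they converge by comparison; their
    limits assemble into the complex one. *)
Lemma abs_cvg_psum u : abs_cvg u ->
  cvgn ((fun N => \sum_(1 <= n < N.+1) u n) : nat -> R[i]^o).
Proof.
rewrite /abs_cvg -(psumE (fun n => normc (u n))) => uc.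
have part (f : R[i] -> R) : {morph f : x y / x + y} ->
    (forall z, `|f z| <= normc z) ->
    exists l, f (\sum_(1 <= n < N.+1) u n) @[N --> \oo] --> (l : R).
  move=> fD fle; have f0 : f 0 = 0 by apply: (addrI (f 0)); rewrite -fD !addr0.
  have : cvgn (series (fun n => f (u n.+1))).
    apply: normed_cvg; apply: series_le_cvg uc => /= n;
      [exact: normr_ge0 | exact: normc_ge0 | exact: fle].
  rewrite (psumE (fun n => f (u n))) => /cvg_ex[l] /= hl; exists l.
  by under eq_fun do rewrite (big_morph f fD f0).
have [a ha] := part (@complex.Re R) (raddfD (@complex.Re R)) normc_ge_abs_Re.
have [b hb] := part (@complex.Im R) (raddfD (@complex.Im R)) normc_ge_abs_Im.
apply/cvg_ex; exists (a +i* b : R[i]^o); apply: cvg_normc.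
apply: (@squeeze_cvgr _ _ _ _ (fun=> 0) (fun N =>
  `|complex.Re (\sum_(1 <= n < N.+1) u n) - a| +
  `|complex.Im (\sum_(1 <= n < N.+1) u n) - b|)).
- apply: nearW => N; rewrite normc_ge0/=.
  by apply: le_trans (normc_le_ReIm _) _; case: (\sum_(1 <= n < N.+1) u n).
- exact: cvg_cst.
- rewrite -[X in _ --> X]addr0; apply: cvgD; apply/norm_cvg0P.
    by rewrite -(subrr a); apply: cvgB => //; exact: cvg_cst.
  by rewrite -(subrr b); apply: cvgB => //; exact: cvg_cst.
Qed.

Lemma normc_dconv_le u v n :
  normc (dconv u v n) <= dconv (@normc R \o u) (@normc R \o v) n.
Proof.
rewrite (le_trans (normc_sum _ _ _ _))// /dconv ler_sum// => d _.
by rewrite /= normcM.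
Qed.

Lemma abs_cvg_le u (b : nat -> R) :
  (forall n, (0 < n)%N -> normc (u n) <= b n) ->
  cvgn (fun N => \sum_(1 <= n < N.+1) b n) -> abs_cvg u.
Proof.
rewrite /abs_cvg -(psumE (fun n => normc (u n))) -psumE => ub.
apply: series_le_cvg => n; [exact: normc_ge0| |exact: ub].
exact: le_trans (normc_ge0 _) (ub _ _).
Qed.

Lemma abs_cvg_dconv u v : abs_cvg u -> abs_cvg v -> abs_cvg (dconv u v).
Proof.
move=> /cvg_ex[a ha] /cvg_ex[b hb].
apply: (@abs_cvg_le _ (dconv (@normc R \o u) (@normc R \o v))).
  by move=> n _; exact: normc_dconv_le.
apply: cvgP; apply: (cvg_psum_dconv _ _ _ _ _ _ ha hb) => n; exact: normc_ge0.
Qed.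

(** Both differences are sums over the pairs of the square with [i * j > N], so the triangle
    inequality applies term by term. *)
Lemma psum_dconv_dist u v N :
  normc ((\sum_(1 <= n < N.+1) u n) * (\sum_(1 <= n < N.+1) v n) -
         \sum_(1 <= n < N.+1) dconv u v n) <=
  (\sum_(1 <= n < N.+1) normc (u n)) * (\sum_(1 <= n < N.+1) normc (v n)) -
  \sum_(1 <= n < N.+1) dconv (@normc R \o u) (@normc R \o v) n.
Proof.
(* Generic in the ring: it serves over [R[i]] on the left and over [R] on the right. *)
have rest (A : comNzRingType) (f g : nat -> A) :
    (\sum_(1 <= n < N.+1) f n) * (\sum_(1 <= n < N.+1) g n) -
    \sum_(1 <= n < N.+1) dconv f g n =
    \sum_(1 <= i < N.+1) \sum_(1 <= j < N.+1 | ~~ (i * j <= N)%N) f i * g j.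
  rewrite sum_dconv mulr_suml -sumrB; apply: eq_bigr => i _.
  rewrite mulr_sumr [X in X - _](bigID (fun j => (i * j <= N)%N))/=.
  by rewrite addrAC subrr add0r.
rewrite !rest (le_trans (normc_sum _ _ _ _))// ler_sum// => i _.
rewrite (le_trans (normc_sum _ _ _ _))// ler_sum// => j _.
by rewrite normcM.
Qed.

Lemma lim_psum_dconv u v : abs_cvg u -> abs_cvg v ->
  limn ((fun N => \sum_(1 <= n < N.+1) dconv u v n) : nat -> R[i]^o) =
  limn ((fun N => \sum_(1 <= n < N.+1) u n) : nat -> R[i]^o) *
  limn ((fun N => \sum_(1 <= n < N.+1) v n) : nat -> R[i]^o).
Proof.
move=> uc vc; have cvu := abs_cvg_psum _ uc; have cvv := abs_cvg_psum _ vc.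
have /cvg_ex[/= a ha] := uc; have /cvg_ex[/= b hb] := vc.
have hab := cvg_psum_dconv _ _ _ _ (fun n => normc_ge0 (u n))
  (fun n => normc_ge0 (v n)) ha hb.
have hP : (\sum_(1 <= n < N.+1) normc (u n)) *
    (\sum_(1 <= n < N.+1) normc (v n)) @[N --> \oo] --> (a * b : R).
  exact: cvgM ha hb.
pose P N : R[i]^o := (\sum_(1 <= n < N.+1) u n) * (\sum_(1 <= n < N.+1) v n).
pose C N : R[i]^o := \sum_(1 <= n < N.+1) dconv u v n.
(* The error for the moduli tends to [a * b - a * b = 0] and squeezes the complex one. *)
have d0 : (P - C) @ \oo --> (0 : R[i]^o).
  apply: cvg_normc; apply: (@squeeze_cvgr _ _ _ _ (fun=> 0) (fun N =>
    (\sum_(1 <= n < N.+1) normc (u n)) * (\sum_(1 <= n < N.+1) normc (v n)) -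
    \sum_(1 <= n < N.+1) dconv (@normc R \o u) (@normc R \o v) n)).
  - by apply: nearW => N; rewrite subr0 normc_ge0/=; exact: psum_dconv_dist.
  - exact: cvg_cst.
  - rewrite -[X in _ --> X](subrr (a * b)); exact: cvgB hP hab.
apply/cvg_lim; first exact: norm_hausdorff.
rewrite -[X in _ --> X]subr0 -/C -(subKr P C).
by apply: cvgB d0; exact: cvgM cvu cvv.
Qed.

End ComplexSeries.

(** * Complex powers of integers and Dirichlet series *)

Section ComplexPower.
Context {R : realType}.
Implicit Types (s z w : R[i]) (a b : nat -> R[i]).

Lemma cexpD z w : cexp (z + w) = cexp z * cexp w.
Proof.
case: z w => [a b] [c d]; apply/eqP; rewrite eq_complex /= expRD cosD sinD.
by apply/andP; split; apply/eqP; ring.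
Qed.

Lemma normc_cexp z : normc (cexp z) = expR (complex.Re z).
Proof.
by rewrite /cexp /= !exprMn -mulrDr cos2Dsin2 mulr1 sqrtr_sqr ger0_norm ?expR_ge0.
Qed.

Lemma natcpowM m n s : (0 < m)%N -> (0 < n)%N ->
  natcpow (m * n) s = natcpow m s * natcpow n s.
Proof.
move=> m0 n0; rewrite /natcpow -cexpD -mulrDr natrM lnM ?posrE ?ltr0n//.
by rewrite rmorphD.
Qed.

Lemma normc_natcpow n s : (0 < n)%N ->
  normc (natcpow n s) = n%:R `^ complex.Re s.
Proof.
move=> n0; rewrite /natcpow normc_cexp /powR pnatr_eq0 gtn_eqF//.
by case: s => x y; rewrite /= mulr0 subr0.
Qed.

(** Since $n^{-1} = e^{-\ln n}$, the terms of $\zeta(s-1)$ are those of the Dirichlet series of the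
    identity at $s$. *)
Lemma natcpowB1 n s : (0 < n)%N -> natcpow n (s - 1) = natcpow n s / n%:R.
Proof.
move=> n0; rewrite /natcpow mulrBl mul1r cexpD; congr (_ * _).
rewrite -rmorphN /cexp /= cos0 sin0 mulr1 mulr0 expRN lnK ?posrE ?ltr0n//.
by rewrite complexr0 fmorphV rmorph_nat.
Qed.

(** $n^s = d^s (n/d)^s$ for every divisor $d$, so the power factors out of the convolution. *)
Lemma dconv_natcpow a b s n : (0 < n)%N ->
  dconv (fun m => a m / natcpow m s) (fun m => b m / natcpow m s) n =
  dconv a b n / natcpow n s.
Proof.
move=> n0; rewrite /dconv mulr_suml big_seq [RHS]big_seq.
apply: eq_bigr => d; rewrite -dvdn_divisors// => dn.
have d0 := dvdn_gt0 n0 dn; have q0 : (0 < n %/ d)%N by rewrite divn_gt0// dvdn_leq.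
have -> : natcpow n s = natcpow d s * natcpow (n %/ d) s.
  by rewrite -natcpowM// mulnC divnK.
by rewrite invfM mulrACA.
Qed.

Definition abs_dirichlet a s : Prop := abs_cvg (fun n => a n / natcpow n s).

(** The index shift hides the value at 0, so identities known only for positive [n] suffice. *)
Lemma eq_dirichlet_terms a b s t :
  (forall n, (0 < n)%N -> a n / natcpow n s = b n / natcpow n t) ->
  dirichlet_terms a s = dirichlet_terms b t.
Proof. by move=> ab; apply/funext => n; exact: ab. Qed.

Lemma series_dirichlet a s : series (dirichlet_terms a s) =
  (fun N => \sum_(1 <= n < N.+1) a n / natcpow n s) :> (nat -> R[i]^o).
Proof. exact: (psumE (fun n => a n / natcpow n s : R[i]^o)). Qed.

Lemma abs_dirichlet_cvg a s : abs_dirichlet a s -> dirichlet_cvg a s.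
Proof. by rewrite /dirichlet_cvg series_dirichlet; exact: abs_cvg_psum. Qed.

Lemma eq_psum_dconv_dirichlet a b s N :
  \sum_(1 <= n < N.+1)
    dconv (fun m => a m / natcpow m s) (fun m => b m / natcpow m s) n =
  \sum_(1 <= n < N.+1) dconv a b n / natcpow n s.
Proof. by apply: eq_big_nat => n /andP[n0 _]; rewrite dconv_natcpow. Qed.

Lemma abs_dirichlet_dconv a b s :
  abs_dirichlet a s -> abs_dirichlet b s -> abs_dirichlet (dconv a b) s.
Proof.
move=> ac bc; apply: (abs_cvg_le _ _ _ (abs_cvg_dconv _ _ ac bc)) => n n0.
by rewrite -dconv_natcpow.
Qed.

Lemma dirichlet_sum_dconv a b s : abs_dirichlet a s -> abs_dirichlet b s ->
  dirichlet_sum (dconv a b) s = dirichlet_sum a s * dirichlet_sum b s.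
Proof.
move=> ac bc; rewrite /dirichlet_sum !series_dirichlet -lim_psum_dconv//.
by rewrite (funext (eq_psum_dconv_dirichlet a b s)).
Qed.

(** Comparison with the p-series of exponent [complex.Re s - p], which exceeds 1. *)
Lemma abs_dirichlet_growth a s (p : R) :
  (forall n, (0 < n)%N -> normc (a n) <= n%:R `^ p) -> p + 1 < complex.Re s ->
  abs_dirichlet a s.
Proof.
move=> ap ps.
apply: (abs_cvg_le _ (fun n => n%:R `^ p / n%:R `^ complex.Re s)) => [n n0|].
  rewrite normcM normcV normc_natcpow// ler_pM2r ?ap//.
  by rewrite invr_gt0 powR_gt0// ltr0n.
rewrite -(psumE (fun n => n%:R `^ p / n%:R `^ complex.Re s)).
have -> : (fun n => n.+1%:R `^ p / n.+1%:R `^ complex.Re s) =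
    riemannR (complex.Re s - p).
  apply/funext => n; rewrite /riemannR -[RHS]powRN opprB powRD ?powRN//.
  by apply/implyP => _; rewrite pnatr_eq0.
by apply: cvg_series_riemannR; rewrite ltrBrDl.
Qed.

End ComplexPower.

(** * Totient identities and the final computation *)

Lemma totient_le n : (totient n <= n)%N.
Proof.
rewrite totient_count_coprime (@leq_trans (\sum_(0 <= d < n) 1))//.
  by apply: leq_sum => d _; case: coprime.
by rewrite sum_nat_const_nat subn0 muln1.
Qed.

(** Gauss's identity $\sum_{d\mid n}\phi(d) = n$. *)
Lemma dconv_totient {A : comNzRingType} n : (0 < n)%N ->
  dconv (fun d => (totient d)%:R) (fun=> 1) n = n%:R :> A.
Proof.
move=> n0; rewrite -{2}(sum_totient_dvd n) natr_sum.
rewrite -(big_mkord (fun d => (d %| n)%N) (fun d => (totient d)%:R)).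
(* The sum in [sum_totient_dvd] starts at [d = 0]; that term drops out because 0 does not divide a
   positive [n]. *)
rewrite [RHS]big_mkcond big_ltn//= dvd0n gtn_eqF// add0r -big_mkcond/=.
rewrite /dconv (perm_big _ (@divisors_perm n n _))?n0 ?leqnn//= big_filter.
by apply: eq_bigr => d _; rewrite mulr1.
Qed.

(** The factor $n$ cancels the $1/n$ in [Nk], and $k^d x^d = (kx)^d$. *)
Lemma zeta2_coefE {R : realType} (k : nat) (x : R) n : (0 < n)%N ->
  zeta2_coef k x n =
  dconv (Li_coef (k%:R * x)%:C) (fun d => (totient d)%:R) n.
Proof.
move=> n0; rewrite /zeta2_coef /Nk mulVKf ?pnatr_eq0 ?gtn_eqF//.
rewrite rmorph_sum; apply: eq_bigr => d _.
by rewrite /Li_coef -mulrA -exprMn mulrC rmorphM rmorphXn rmorph_nat.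
Qed.

Theorem theorem8 (R : realType) (k : nat) (x : R) (s : R[i])
  (hs : 2 < complex.Re s) (hkx : `|k%:R * x| < 1) :
  [/\ dirichlet_cvg (@zeta_coef R) s,
      dirichlet_cvg (@zeta_coef R) (s - 1),
      dirichlet_cvg (Li_coef (k%:R * x)%:C) s,
      dirichlet_cvg (zeta2_coef k x) s
    & zeta s * zeta2 x s k = zeta (s - 1) * Li s (k%:R * x)%:C].
Proof.
pose phi d : R[i] := (totient d)%:R; pose z : R[i] := (k%:R * x)%:C.
have normc_nat n : normc (n%:R : R[i]) = n%:R.
  by rewrite -(rmorph_nat (real_complex R)) normc_real normr_nat.
have one_s : abs_dirichlet (@zeta_coef R) s.
  apply: (abs_dirichlet_growth _ _ 0) => [n _|]; last by lra.
  by rewrite powRr0 /zeta_coef normc1.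
(* Growth exponent 0: [hkx] bounds all powers of [z] by 1. *)
have Li_s : abs_dirichlet (Li_coef z) s.
  apply: (abs_dirichlet_growth _ _ 0) => [n _|]; last by lra.
  rewrite powRr0 /Li_coef /z -rmorphXn normc_real normrX.
  by rewrite exprn_ile1// ltW.
(* Growth exponent 1, here and for the identity, calls for [1 + 1 < complex.Re s], which is [hs]. *)
have phi_s : abs_dirichlet phi s.
  apply: (abs_dirichlet_growth _ _ 1) => [n _|]; last by lra.
  by rewrite powRr1// normc_nat ler_nat totient_le.
have id_s : abs_dirichlet (fun n => n%:R) s.
  apply: (abs_dirichlet_growth _ _ 1) => [n _|]; last by lra.
  by rewrite powRr1// normc_nat.
have one_sE : dirichlet_terms (@zeta_coef R) (s - 1) =
    dirichlet_terms (fun n => n%:R) s.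
  apply: eq_dirichlet_terms => n n0.
  by rewrite natcpowB1// invf_div /zeta_coef mul1r.
have zeta2E : dirichlet_terms (zeta2_coef k x) s =
    dirichlet_terms (dconv (Li_coef z) phi) s.
  by apply: eq_dirichlet_terms => n n0; rewrite zeta2_coefE.
have zeta2_s := abs_dirichlet_dconv _ _ _ Li_s phi_s.
(* Associativity brings the constant 1 next to [phi], where Gauss's identity applies. *)
have convE : dirichlet_terms (dconv (dconv (Li_coef z) phi) (@zeta_coef R)) s =
    dirichlet_terms (dconv (Li_coef z) (fun n => n%:R)) s.
  apply: eq_dirichlet_terms => n n0; congr (_ / _).
  rewrite dconvA// /dconv big_seq [RHS]big_seq; apply: eq_bigr => d.
  rewrite -dvdn_divisors// => dn; congr (_ * _).
  by apply: dconv_totient; rewrite divn_gt0 ?(dvdn_gt0 n0 dn)// dvdn_leq.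
split; try exact: abs_dirichlet_cvg.
- by rewrite /dirichlet_cvg one_sE; exact: abs_dirichlet_cvg.
- by rewrite /dirichlet_cvg zeta2E; exact: abs_dirichlet_cvg.
have -> : zeta2 x s k = dirichlet_sum (dconv (Li_coef z) phi) s.
  by rewrite /zeta2 /dirichlet_sum zeta2E.
have -> : zeta (s - 1) = dirichlet_sum (fun n => n%:R) s.
  by rewrite /zeta /dirichlet_sum one_sE.
rewrite mulrC [RHS]mulrC -!dirichlet_sum_dconv//.
by rewrite /dirichlet_sum convE.
Qed.
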